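(* Let $\mathcal{A}$ be a (transition-based) Emerson–Lei automaton with $n$ states and $k$ colours. Then there exists a generalized Büchi automaton with $2^k$ colours and $O(k^{n2^k}\cdot\mathrm{tight}(n+1)^{2^k})$ states accepting $\Sigma^\omega\setminus\mathcal{L}(\mathcal{A})$; using the known estimate $\mathrm{tight}(n)\approx(0.76n)^n$, this is $O(n^{2^k}(0.76nk)^{n2^k})$ states.
   Context: A (transition-based) Emerson–Lei automaton (TELA) over finite $\Sigma$ is $(Q,\delta,I,\Gamma,p,\mathit{Acc})$ with finite states $Q$, $\delta\subseteq Q\times\Sigma\times Q$, $I\subseteq Q$, colours $\Gamma=\{0,\dots,k-1\}$, colouring $p:\delta\to2^\Gamma$ and $\mathit{Acc}$ a formula built from $\mathit{true},\mathit{false}$ and atoms $\mathrm{Inf}(c),\mathrm{Fin}(c)$ ($c\in\Gamma$) using $\wedge,\vee$; a run is accepting iff the set $M$ of colours on transitions occurring infinitely often satisfies $\mathit{Acc}$ ($\mathrm{Inf}(c)$ iff $c\in M$, $\mathrm{Fin}(c)$ iff $c\notin M$); the language consists of words with an accepting run from an initial state. A generalized Büchi automaton with $m$ colours has $\mathit{Acc}=\bigwedge_{0\le j<m}\mathrm{Inf}(j)$. $\mathrm{tight}(n)$ is the number of functions $f:\{1,\dots,n\}\to\omega$ whose maximum $r$ is odd and whose image contains $\{1,3,\dots,r\}$. *)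

(* Defs.v *)
From mathcomp Require Import all_boot.

Set Implicit Arguments.
Unset Strict Implicit.
Unset Printing Implicit Defensive.

Inductive formula (k : nat) : Type :=
| FTrue
| FFalse
| FInf (c : 'I_k)
| FFin (c : 'I_k)
| FAnd (phi psi : formula k)
| FOr (phi psi : formula k).
Arguments FTrue {k}.
Arguments FFalse {k}.

Fixpoint sat (k : nat) (M : 'I_k -> Prop) (phi : formula k) : Prop :=
  match phi with
  | FTrue => True
  | FFalse => False
  | FInf c => M c
  | FFin c => ~ M c
  | FAnd phi1 phi2 => sat M phi1 /\ sat M phi2
  | FOr phi1 phi2 => sat M phi1 \/ sat M phi2
  end.

(* [colour] is total on triples; only its values on [trans] matter, since runs
   use no other triples. *)
Record tela (Sigma : finType) (k : nat) := Tela {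
  state : finType;
  trans : {set state * Sigma * state};
  init : {set state};
  colour : state * Sigma * state -> {set 'I_k};
  acc : formula k
}.

Section Language.
Variables (Sigma : finType) (k : nat) (A : tela Sigma k).
Implicit Types (w : nat -> Sigma) (r : nat -> state A).

Definition step w r (i : nat) : state A * Sigma * state A :=
  (r i, w i, r i.+1).

Definition is_run w r : Prop := forall i, step w r i \in trans A.

Definition inf_often w r (t : state A * Sigma * state A) : Prop :=
  forall i, exists2 j, i <= j & step w r j = t.

Definition inf_colours w r (c : 'I_k) : Prop :=
  exists2 t, inf_often w r t & c \in colour t.

Definition accepting w r : Prop := sat (inf_colours w r) (acc A).

Definition language w : Prop :=
  exists r, [/\ r 0 \in init A, is_run w r & accepting w r].

Definition generalized_buchi : Prop :=
  acc A = \big[@FAnd k/FTrue]_(j < k) FInf j.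

End Language.

(* The maximum over the empty domain is 0, which is even, so no function is
   tight for n = 0. *)
Definition is_tight (n : nat) (f : 'I_n -> nat) : bool :=
  let r := \max_(i < n) f i in
  odd r && [forall s : 'I_r.+1, odd s ==> [exists i, f i == s]].

Lemma is_tight_lt (n : nat) (f : 'I_n -> nat) :
  is_tight f -> forall i, f i < n.*2.
Proof.
rewrite /is_tight; set r := \max_(i < n) f i => /andP[r_odd /forallP img] i.
have rE : r = (r./2).*2.+1 by rewrite -[LHS]odd_double_half r_odd.
apply: (@leq_ltn_trans r); first exact: leq_bigmax.
suff r2n : r./2 < n by rewrite rE -doubleS leq_double.
have hit (s : 'I_(r./2).+1) : exists i, f i == s.*2.+1.
  have s_lt : s.*2.+1 < r.+1.
    by rewrite ltnS [leqRHS]rE ltnS leq_double -ltnS ltn_ord.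
  have s_odd : odd s.*2.+1 by rewrite /= odd_double.
  by have /existsP := implyP (img (Ordinal s_lt)) s_odd.
pose g s := xchoose (hit s).
have g_inj : injective g.
  move=> s t st; apply/val_inj/double_inj/succn_inj.
  by rewrite -(eqP (xchooseP (hit s))) -(eqP (xchooseP (hit t))) -/(g s) st.
by have := leq_card g g_inj; rewrite !card_ord.
Qed.

(* Counting functions into {0, ..., 2n-1} loses nothing, by [is_tight_lt]. *)
Definition tight (n : nat) : nat :=
  #|[set f : {ffun 'I_n -> 'I_n.*2} | is_tight (fun i => f i)]|.

(* Main.v *)
Require Import Defs.
From mathcomp Require Import all_boot all_order all_algebra.
From mathcomp Require Import perm boolp lra.

Set Implicit Arguments.
Unset Strict Implicit.
Unset Printing Implicit Defensive.

Import Order.TTheory GRing.Theory Num.Theory.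

(** A set M of colours satisfies the acceptance condition iff it lies in one of
    at most 2^(k-1) cubes "disjoint from F_j and containing I_j": group the sets
    M by M minus {0}.  So a word is rejected iff for every j no run eventually
    avoids F_j while seeing every colour of I_j infinitely often.  The
    complement tracks the reachable set and, for every j, guesses a level
    ranking of the reachable states in the style of Kupferman and Vardi, which
    is constrained only along transitions without colours of F_j: ranks do not
    increase, an odd rank carries a colour of I_j and decreases at transitions
    of that colour, and a breakpoint set checks that no path stays at an even
    rank.  With n states a component takes at most (6nk)^n values.  As there
    are half as many components as colours of the automaton, a component may
    cost (k^n tight(n+1))^2, of order (nk)^(2n) up to a factor c^n; it does
    unless nk is bounded, and then so is the number of states. *)

(** * Infinite sequences by choice, pigeonhole and compactness *)

Lemma dependent_choice_from (T : Type) (P : nat -> T -> Prop)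
    (S : nat -> T -> T -> Prop) (N : nat) (x0 : T) :
  P N x0 ->
  (forall i x, N <= i -> P i x -> exists2 y, P i.+1 y & S i x y) ->
  exists r : nat -> T,
    r N = x0 /\ forall i, N <= i -> P i (r i) /\ S i (r i) (r i.+1).
Proof.
move=> P0 PS.
have /choice [g gP] (p : nat * T) :
    exists y, N <= p.1 -> P p.1 p.2 -> P p.1.+1 y /\ S p.1 p.2 y.
  case: (pselect (N <= p.1 /\ P p.1 p.2)) => [[Np Pp]|nP].
    by have [y Py Sy] := PS _ _ Np Pp; exists y.
  by exists p.2 => Np Pp; case: nP.
pose fix h d := if d is d'.+1 then g (N + d', h d') else x0.
have hP d : P (N + d) (h d).
  elim: d => [|d IH]; first by rewrite addn0.
  by rewrite addnS; apply: (proj1 (gP (N + d, h d) _ _)); rewrite ?leq_addr.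
exists (fun i => h (i - N)); split; first by rewrite subnn.
move=> i Ni; rewrite subSn //=.
have := hP (i - N); rewrite subnKC // => Pi; split=> //.
by have [] := gP (i, h (i - N)) Ni Pi.
Qed.

(** Otherwise each [x] has a bound beyond which [P x] fails, and beyond the largest of these
    finitely many bounds every [x] fails. *)
Lemma fin_pigeonhole (T : finType) (P : T -> nat -> Prop) :
  (forall i, exists x, exists2 j, i <= j & P x j) ->
  exists x, forall i, exists2 j, i <= j & P x j.
Proof.
move=> allP; apply: contrapT => /forallNP nP.
have /choice [b bP] x : exists i, forall j, i <= j -> ~ P x j.
  have /existsNP[i ni] := nP x; exists i => j ij Pj; apply: ni.
  by exists j.
have [x [j lej]] := allP (\max_x b x).
by apply: (bP x); apply: leq_trans lej; apply: leq_bigmax.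
Qed.

(** Following predecessors back from level [i + d] shows that level [i] starts paths of every length
    [d]. As [T] is finite, some vertex starts paths of all lengths, and then so does one of its
    successors. *)
Lemma konig (T : finType) (E : nat -> rel T) (V : nat -> {set T}) (N : nat) :
  (forall i, N <= i -> V i != set0) ->
  (forall i y, N <= i -> y \in V i.+1 -> exists2 x, x \in V i & E i x y) ->
  exists r, forall i, N <= i -> r i \in V i /\ E i (r i) (r i.+1).
Proof.
move=> Vn0 Vpre.
pose fix long (d i : nat) (x : T) {struct d} : Prop := x \in V i /\
  if d is d'.+1 then exists2 y, E i x y & long d' i.+1 y else True.
have longW d e i x : d <= e -> long e i x -> long d i x.
  elim: d e i x => [|d IH] [|e] i x //= de [Vx] // [y Exy ly].
  by split=> //; exists y => //; apply: IH ly.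
have ex_alive (P : T -> Prop) i :
    (forall d, exists2 x, P x & long d i x) ->
    exists2 x, P x & forall d, long d i x.
  move=> Pl; have [|x xP] := @fin_pigeonhole T (fun x d => P x /\ long d i x).
    by move=> d; have [x Px lx] := Pl d; exists x; exists d.
  exists x; first by have [? _ []] := xP 0.
  by move=> d; have [e de [_]] := xP d; apply: longW.
have long_start i d : N <= i -> exists2 x, True & long d i x.
  move=> Ni; elim: d i Ni => [|d IH] i Ni.
    by have /set0Pn[x Vx] := Vn0 _ Ni; exists x.
  have [y _ ly] := IH i.+1 (leqW Ni).
  have [|x Vx Exy] := Vpre i y Ni; first by case: d ly {IH} => [|d] [].
  by exists x => //; split=> //; exists y.
have [x _ xl] := ex_alive (fun=> True) N (fun d => long_start N d (leqnn N)).
have [|r [_ rP]] := @dependent_choice_from _ (fun i x => forall d, long d i x)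
    (fun i x y => E i x y) N x xl.
  move=> i y Ni ly.
  have [|z Eyz lz] := ex_alive (fun z => E i y z) i.+1; last by exists z.
  by move=> d; have [_] := ly d.+1.
by exists r => i Ni; have [/(_ 0)[Vr _] Er] := rP i Ni.
Qed.

(** * Rankings of layered graphs without a generalized Büchi path *)

Section Ranking.
Variables (Q : finType) (k : nat) (c0 : 'I_k).
Variables (E : nat -> rel Q) (col : nat -> Q -> Q -> {set 'I_k}).
Variable I : {set 'I_k}.
Implicit Types (G : nat -> {set Q}) (r : nat -> Q).

(* Entries of r below N are junk. *)
Definition path_from G N r := forall i, N <= i -> r i \in G i /\ E i (r i) (r i.+1).

Definition no_gen_buchi_path G := forall N r, path_from G N r ->
  exists2 c, c \in I & exists M, forall i, M <= i -> c \notin col i (r i) (r i.+1).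

(** At an equal number the colour must stay equal too: a path whose numbers stop decreasing settles
    on one pair and, if the number is odd, never sees the colour of that pair again. *)
Definition rank_step (cs : {set 'I_k}) (x y : nat * 'I_k) : bool :=
  (y.1 < x.1) || ((y == x) && ~~ (odd x.1 && (x.2 \in cs))).

Definition infinite_part G i : {set Q} :=
  [set q in G i | `[< exists2 r, r i = q & path_from G i r >]].

Lemma infinite_part_sub G i : infinite_part G i \subset G i.
Proof. by apply/subsetP=> q; rewrite inE => /andP[]. Qed.

Lemma path_infinite_part G N r :
  path_from G N r -> path_from (infinite_part G) N r.
Proof.
move=> rG i Ni; have [rGi rE] := rG i Ni; split=> //.
rewrite inE rGi; apply/asboolP; exists r => // j ij.
by apply: rG; apply: leq_trans ij.
Qed.

Lemma infinite_part_path G i q :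
  q \in infinite_part G i ->
  exists2 r, r i = q & path_from (infinite_part G) i r.
Proof.
by rewrite inE => /andP[_ /asboolP[r rq /path_infinite_part rG]]; exists r.
Qed.

Lemma infinite_part_pred G i q q' :
  q \in G i -> E i q q' -> q' \in infinite_part G i.+1 ->
  q \in infinite_part G i.
Proof.
move=> Gq Eqq' /infinite_part_path[r rq' rG]; rewrite inE Gq; apply/asboolP.
exists (fun j => if j == i then q else r j); first by rewrite eqxx.
move=> j; rewrite leq_eqVlt eq_sym => /orP[/eqP->|ij].
  by rewrite eqxx gtn_eqF // rq'.
have [Gr Er] := rG j ij; rewrite !gtn_eqF ?(leqW ij) //; split=> //.
by apply: (subsetP (infinite_part_sub G j)).
Qed.

(** [d] counts the transitions before the one that carries [c]. *)
Fixpoint meets G (c : 'I_k) d i q : Prop :=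
  exists2 q', q' \in G i.+1 /\ E i q q' &
    if d is d'.+1 then meets G c d' i.+1 q' else c \in col i q q'.

(* Serving the colours cyclically, each reached by finitely many steps, would
   yield a path on which every colour of I recurs. *)
Lemma ex_colour_free G :
  (forall i q, q \in G i -> exists2 q', q' \in G i.+1 & E i q q') ->
  no_gen_buchi_path G ->
  forall i0 q0, q0 \in G i0 ->
  exists2 c, c \in I & exists i q, q \in G i /\ forall d, ~ meets G c d i q.
Proof.
move=> Gsucc Gno i0 q0 Gq0; apply: contrapT => nofree.
have meetsI c i q : c \in I -> q \in G i -> exists d, meets G c d i q.
  move=> cI Gq; apply: contrapT => /forallNP nm; apply: nofree.
  by exists c => //; exists i, q.
have k_gt0 : 0 < k by case: k c0 => [[]|].
pose tgt t : 'I_k := Ordinal (ltn_pmod t k_gt0).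
(* A state is a vertex, a counter and a countdown. The counter modulo [k] names the colour to be
   served, the countdown is the number of transitions before the one that carries it, and the
   counter advances when that one is taken. A colour outside [I] imposes nothing. *)
pose Pst i (x : Q * nat * nat) :=
  x.1.1 \in G i /\ (tgt x.1.2 \in I -> meets G (tgt x.1.2) x.2 i x.1.1).
pose Sst i (x y : Q * nat * nat) := E i x.1.1 y.1.1 /\
  if x.2 is d.+1 then y.1.2 = x.1.2 /\ y.2 = d
  else y.1.2 = x.1.2.+1 /\ (tgt x.1.2 \in I -> tgt x.1.2 \in col i x.1.1 y.1.1).
have Pex i q t : q \in G i -> exists d, Pst i (q, t, d).
  move=> Gq; case: (boolP (tgt t \in I)) => [tI|tI].
    by have [d md] := meetsI _ i q tI Gq; exists d.
  by exists 0; split=> //= tI'; rewrite tI' in tI.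
have [d0 Pd0] := Pex i0 q0 0 Gq0.
have [|r [_ rP]] := @dependent_choice_from _ Pst Sst i0 _ Pd0.
  move=> i [[q t] [|d]] _ [/= Gq m].
    have [q' [Gq' Eqq'] cq'] : exists2 q', q' \in G i.+1 /\ E i q q' &
        tgt t \in I -> tgt t \in col i q q'.
      case: (boolP (tgt t \in I)) => [tI|_]; last first.
        by have [q' ? ?] := Gsucc _ _ Gq; exists q'.
      by have [q' ? ?] := m tI; exists q'.
    by have [d Pd] := Pex i.+1 q' t.+1 Gq'; exists (q', t.+1, d).
  have [q' [Gq' Eqq'] m'] : exists2 q', q' \in G i.+1 /\ E i q q' &
      tgt t \in I -> meets G (tgt t) d i.+1 q'.
    case: (boolP (tgt t \in I)) => [tI|_]; last first.
      by have [q' ? ?] := Gsucc _ _ Gq; exists q'.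
    by have [q' ? ?] := m tI; exists q'.
  by exists (q', t, d).
have serve d i : i0 <= i -> (r i).2 = d ->
    exists j, [/\ i <= j, (r j).2 = 0 & (r j).1.2 = (r i).1.2].
  elim: d i => [|d IH] i i0i rd; first by exists i.
  have [_ [_]] := rP i i0i; rewrite rd => -[tE dE].
  have [j [ij j0 jt]] := IH i.+1 (leqW i0i) dE.
  by exists j; split; [exact: ltnW | | rewrite jt].
have serves m i : i0 <= i ->
    exists j, [/\ i <= j, (r j).2 = 0 & (r j).1.2 = (r i).1.2 + m].
  move=> i0i; elim: m => [|m [j [ij j0 jt]]].
    by rewrite addn0; apply: serve.
  have i0j := leq_trans i0i ij.
  have [_ [_]] := rP j i0j; rewrite j0 => -[tE _].
  have [j' [jj' j'0 j't]] := serve _ j.+1 (leqW i0j) erefl.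
  by exists j'; rewrite j't tE jt addnS; split=> //; apply/ltnW/(leq_ltn_trans ij).
have [|c cI [M cM]] := Gno i0 (fun i => (r i).1.1).
  by move=> i i0i; have [[]] := rP i i0i; move=> ? _ [].
pose i := maxn i0 M; pose t := (r i).1.2.
have i0i : i0 <= i by apply: leq_maxl.
(* This moves the counter from [t] to [k * t + c], which is [c] modulo [k]; [0 < k] keeps the
   subtraction from truncating. *)
have [j [ij j0 jt]] := serves (k * t + c - t) i i0i.
have tc : tgt (r j).1.2 = c.
  apply/val_inj; rewrite /= jt -/t subnKC.
    by rewrite mulnC modnMDl modn_small.
  by apply: leq_trans (leq_addr _ _); apply: leq_pmull.
have [_ [_]] := rP j (leq_trans i0i ij); rewrite j0 tc => -[_ /(_ cI)].
by apply/negP/cM; apply: leq_trans ij; apply: leq_maxr.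
Qed.

(* If infinite paths remain, some vertex of the infinite part cannot reach the
   colour c in it.  Give rank (1, c) to all such vertices; since they lie on an
   infinite path, removing them lowers the width. *)
Lemma ranking_exists n G :
  (exists L, forall i, L <= i -> #|G i| <= n) ->
  no_gen_buchi_path G ->
  exists f : nat -> Q -> nat * 'I_k,
  [/\ forall i q, (f i q).1 <= n.*2,
      forall i q, odd (f i q).1 -> (f i q).2 \in I,
      forall i q q', q \in G i -> q' \in G i.+1 -> E i q q' ->
        rank_step (col i q q') (f i q) (f i.+1 q')
    & forall N r, path_from G N r -> exists2 i, N <= i & odd (f i (r i)).1].
Proof.
elim: n G => [|n IH] G [L width] Gno.
  exists (fun _ _ => (0, c0)); split=> // [i q q' _ _ _|N r rG].
    by rewrite /rank_step /= eqxx.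
  have [rL _] := rG (maxn N L) (leq_maxl _ _).
  by have := width _ (leq_maxr N L); rewrite leqn0 => /eqP/cards0_eq r0;
    rewrite r0 inE in rL.
set G' := infinite_part G.
case: (pselect (exists i q, q \in G' i)) => [[i0 [q0 Gq0]]|noinf]; last first.
  exists (fun _ _ => (0, c0)); split=> // [i q q' _ _ _|N r rG].
    by rewrite /rank_step /= eqxx.
  case: noinf; exists N, (r N).
  by have [] := path_infinite_part rG (leqnn N).
have G'G i : G' i \subset G i by apply: infinite_part_sub.
have Gno' : no_gen_buchi_path G'.
  move=> N r rG'; apply: (Gno N r) => i Ni; have [Gr Er] := rG' i Ni.
  by split=> //; apply: (subsetP (G'G i)).
have [c cI [N [q1 [Gq1 free1]]]] : exists2 c, c \in I &
    exists i q, q \in G' i /\ forall d, ~ meets G' c d i q.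
  apply: (@ex_colour_free G') Gq0 => // i q /infinite_part_path[r rq rG].
  have [_ Er] := rG i (leqnn i); have [Gr _] := rG i.+1 (leqnSn i).
  by exists (r i.+1) => //; rewrite -rq.
pose H i := [set q in G' i | `[< forall d, ~ meets G' c d i q >]].
have H_next i q q' : q \in H i -> q' \in G' i.+1 -> E i q q' ->
    q' \in H i.+1 /\ c \notin col i q q'.
  rewrite inE => /andP[_ /asboolP free] Gq' Eqq'; split.
    rewrite inE Gq'; apply/asboolP=> d m; apply: (free d.+1); exists q' => //.
  by apply/negP=> cc; apply: (free 0); exists q'.
have [||f [f_le f_odd f_step f_path]] := IH (fun i => G' i :\: H i).
- have [r rN rG'] := infinite_part_path Gq1.
  (* Successors of [H] inside [G'] stay in [H], so a whole path is removed: from level [N] on, every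
     level loses a vertex. *)
  have rH i : N <= i -> r i \in H i.
    elim: i => [|i IHi]; rewrite leq_eqVlt => /orP[/eqP Ni|].
    + by rewrite -Ni rN inE Gq1; apply/asboolP.
    + by [].
    + by rewrite -Ni rN inE Gq1; apply/asboolP.
    + rewrite ltnS => Ni; have [_ Er] := rG' i Ni.
      have [Gr _] := rG' i.+1 (leqW Ni).
      by have [] := H_next i _ _ (IHi Ni) Gr Er.
  exists (maxn L N) => i; rewrite geq_max => /andP[Li Ni].
  have := width i Li; rewrite (cardsD1 (r i)).
  have [/(subsetP (G'G i)) -> _] := rG' i Ni; rewrite ltnS.
  apply: leq_trans; apply: subset_leq_card; apply/subsetP=> q /setDP[Gq nH].
  rewrite in_setD1 (subsetP (G'G i) _ Gq) andbT.
  by apply: contraNneq nH => ->; apply: rH.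
- move=> M r rG; apply: (Gno M r) => i Mi; have [/setDP[Gr _] Er] := rG i Mi.
  by split=> //; apply: (subsetP (G'G i)).
(* Vertices without an infinite path get rank 0, those of [H] rank 1. Raising the other ranks by 2
   keeps their parity and makes entering [H] a descent. *)
exists (fun i q => if q \in G' i then
  if q \in H i then (1, c) else ((f i q).1.+2, (f i q).2) else (0, c0)).
split.
- move=> i q; case: ifP => // _; case: ifP => // _.
  by rewrite /= doubleS !ltnS f_le.
- move=> i q; case: ifP => // _; case: ifP => //= _; rewrite negbK.
  exact: f_odd.
- move=> i q q' Gq Gq' Eqq'; rewrite /rank_step.
  case: (boolP (q' \in G' i.+1)) => [G'q'|nG'q']; last first.
    by case: (q \in G' i); case: (q \in H i); rewrite /= ?eqxx.
  rewrite (infinite_part_pred Gq Eqq' G'q').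
  case: (boolP (q \in H i)) => [Hq|nHq].
    have [-> cc] := H_next _ _ _ Hq G'q' Eqq'.
    by rewrite /= eqxx.
  case: ifP => // /negbT nHq' /=.
  have := f_step i q q'; rewrite !in_setD nHq nHq' G'q'.
  rewrite (infinite_part_pred Gq Eqq' G'q') => /(_ isT isT Eqq').
  rewrite /rank_step negbK /= !ltnS => /orP[->//|/andP[/eqP-> ->]].
  by rewrite eqxx orbT.
(* A path without odd ranks avoids [H], hence lies in the graph of the induction hypothesis, which
   gives it an odd rank. *)
- move=> M r rG; apply: contrapT => noodd.
  have rG' := path_infinite_part rG.
  have [|i Mi oddf] := f_path M r.
    move=> i Mi; have [Gr Er] := rG' i Mi; split=> //.
    rewrite inE Gr andbT; apply/negP=> Hr; apply: noodd.
    by exists i => //; rewrite Gr Hr.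
  apply: noodd; exists i => //; have [Gr _] := rG' i Mi; rewrite Gr.
  by case: ifP => //=; rewrite negbK.
Qed.
End Ranking.

(** * Eventual behaviour of sequences *)

Lemma eventually_constant (u : nat -> nat) (N : nat) :
  (forall i, N <= i -> u i.+1 <= u i) ->
  exists2 N', N <= N' & forall i, N' <= i -> u i = u N'.
Proof.
move: {2}(u N).+1 (ltnSn (u N)) => b; elim: b N => // b IH N uN dec.
case: (pselect (exists2 i, N <= i & u i < u N)) => [[i Ni ui]|nlt].
  have [||N' iN' cN'] := IH i.
  - by apply: leq_trans ui _.
  - by move=> l il; apply: dec; apply: leq_trans il.
  - by exists N' => //; apply: leq_trans iN'.
exists N => // i Ni; apply/eqP; rewrite eqn_leq; apply/andP; split.
  elim: i Ni => [|i IHi]; rewrite leq_eqVlt => /orP[/eqP->//|//].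
  by rewrite ltnS => Ni; apply: leq_trans (dec i Ni) (IHi Ni).
by rewrite leqNgt; apply/negP=> ui; apply: nlt; exists i.
Qed.

Lemma fin_eventually (T : finType) (D : pred T) (P : T -> nat -> Prop) :
  (forall x, D x -> exists N, forall i, N <= i -> P x i) ->
  exists N, forall i, N <= i -> forall x, D x -> P x i.
Proof.
move=> ev; have /choice[b bP] x : exists N, D x -> forall i, N <= i -> P x i.
  case: (boolP (D x)) => [/ev[N NP]|nD]; first by exists N.
  by exists 0.
exists (\max_x b x) => i bi x Dx; apply: bP => //.
by apply: leq_trans bi; apply: leq_bigmax.
Qed.

(** * Acceptance formulas and their cover by cubes *)

Section Sat.
Variable k : nat.

Lemma sat_iff (M M' : 'I_k -> Prop) phi :
  (forall c, M c <-> M' c) -> sat M phi <-> sat M' phi.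
Proof. by move=> MM'; elim: phi => /=; firstorder. Qed.

Lemma sat_big_FAnd (M : 'I_k -> Prop) :
  sat M (\big[@FAnd k/FTrue]_(j < k) FInf j) <-> forall j, M j.
Proof.
suff sat_seq s : sat M (\big[@FAnd k/FTrue]_(j <- s) FInf j) <->
    forall j, j \in s -> M j.
  by rewrite sat_seq; split=> allM j => [|_]; apply: allM; rewrite ?mem_index_enum.
elim: s => [|i s IH]; first by rewrite big_nil.
rewrite big_cons /= IH; split=> [[Mi Ms] j|allM].
  by rewrite inE => /orP[/eqP->|/Ms].
by split=> [|j js]; apply: allM; rewrite inE ?eqxx ?js ?orbT.
Qed.

End Sat.

(* Merging M with M xor {ord0} halves the number of cubes. *)
Lemma cube_cover k (P : pred {set 'I_k.+1}) :
  exists F I : {set 'I_k} -> {set 'I_k.+1},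
  forall M : {set 'I_k.+1},
  P M = [exists X, [disjoint F X & M] && (I X \subset M)].
Proof.
pose low (M : {set 'I_k.+1}) : {set 'I_k} := lift ord0 @^-1: M.
pose up (X : {set 'I_k}) : {set 'I_k.+1} := lift ord0 @: X.
have lowE (M : {set 'I_k.+1}) X : [disjoint up (~: X) & M] && (up X \subset M) = (X == low M).
  apply/andP/eqP => [[/pred0P dis /subsetP sub]|->].
    apply/setP=> c; rewrite inE; case: (boolP (c \in X)) => cX.
      by rewrite sub //; apply: imset_f.
    by have := dis (lift ord0 c); rewrite /= imset_f ?inE.
  split; last by apply/subsetP=> _ /imsetP[c cM ->]; rewrite inE in cM.
  by apply/pred0P=> x /=; apply/negP=> /andP[/imsetP[c]]; rewrite !inE => /negP cM ->.
have ME (M : {set 'I_k.+1}) X : X == low M -> M = if ord0 \in M then ord0 |: up X else up X.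
  move=> /eqP->; apply/setP=> c; case: (unliftP ord0 c) => [c'|] ->.
    have e : (lift ord0 c' \in up (low M)) = (lift ord0 c' \in M).
      by rewrite mem_imset ?inE //; apply: lift_inj.
    by case: ifP => _; rewrite ?inE ?e // eq_sym (negPf (neq_lift _ _)).
  case: ifP => [M0|nM0]; first by rewrite !inE eqxx.
  symmetry; apply/imsetP=> -[c' _ /eqP].
  by rewrite (negPf (neq_lift _ _)).
have /choice[FI FIP] (X : {set 'I_k}) : exists p : {set 'I_k.+1} * {set 'I_k.+1},
    forall M : {set 'I_k.+1}, [disjoint p.1 & M] && (p.2 \subset M) = P M && (X == low M).
  have disjU (S M : {set 'I_k.+1}) :
      [disjoint ord0 |: S & M] = (ord0 \notin M) && [disjoint S & M].
    by rewrite -!setI_eq0 setIUl setU_eq0 !setI_eq0 disjoints1.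
  have subU (S M : {set 'I_k.+1}) :
      (ord0 |: S \subset M) = (ord0 \in M) && (S \subset M).
    by rewrite subUset sub1set.
  (* The sets with trace [X] are [up X] and [ord0 |: up X]. If [P] holds of both, [ord0] is left
     free; if of one, [ord0] is forbidden or required; if of none, it is both, and the cube is
     empty. *)
  exists (if P (ord0 |: up X) || P (up X) then
    (if P (ord0 |: up X) then up (~: X) else ord0 |: up (~: X),
     if P (up X) then up X else ord0 |: up X) else ([set ord0], [set ord0])).
  move=> M; case: (boolP (X == low M)) => XM; last first.
    rewrite andbF; apply: contraNF XM; rewrite -lowE.
    case: (P _); case: (P _); rewrite /= ?disjU ?subU ?disjoints1 ?sub1set //.
    - by move=> /and3P[-> _ ->].
    - by move=> /andP[/andP[_ ->] ->].
    - by case: (_ \in M).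
  rewrite andbT {3}(ME M X XM) (fun_if P).
  have := XM; rewrite -lowE => /andP[dis sub].
  case: (P _); case: (P _); rewrite /= ?disjU ?subU ?disjoints1 ?sub1set ?dis ?sub;
    by case: (_ \in M).
exists (fun X => (FI X).1), (fun X => (FI X).2) => M.
apply/idP/existsP => [PM|[X]]; last by rewrite FIP => /andP[].
by exists (low M); rewrite FIP PM eqxx.
Qed.

(** * Recurring colours and reachable sets *)

Section Runs.
Variables (Sigma : finType) (k : nat) (A : tela Sigma k).
Implicit Types (w : nat -> Sigma) (r : nat -> state A) (S : {set state A}).

(** There are finitely many transitions, so a colour seen infinitely often lies on a single
    transition taken infinitely often. *)
Lemma inf_coloursP w r c :
  inf_colours w r c <-> forall i, exists2 j, i <= j & c \in colour (step w r j).
Proof.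
split=> [[t tinf ct] i|cinf].
  by have [j ij jt] := tinf i; exists j; rewrite ?jt.
have [|t tP] := @fin_pigeonhole (state A * Sigma * state A)%type
    (fun t j => step w r j = t /\ c \in colour t).
  by move=> i; have [j ij jt] := cinf i; exists (step w r j), j.
exists t => [i|]; first by have [j ij []] := tP i; exists j.
by have [j _ []] := tP 0.
Qed.

Lemma not_inf_coloursP w r c :
  ~ inf_colours w r c <->
  exists N, forall i, N <= i -> c \notin colour (step w r i).
Proof.
rewrite inf_coloursP; split=> [ninf|[N nc] /(_ N)[i /nc/negP]//].
apply: contrapT => /forallNP nN; apply: ninf => i.
by apply: contrapT => ni; apply: (nN i) => j ij; apply/negP=> cj; apply: ni; exists j.
Qed.

Definition post S (a : Sigma) : {set state A} :=
  [set q' | [exists q in S, (q, a, q') \in trans A]].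

Fixpoint reach w i : {set state A} :=
  if i is i'.+1 then post (reach w i') (w i') else init A.

Lemma mem_post S a q q' : q \in S -> (q, a, q') \in trans A -> q' \in post S a.
Proof. by move=> Sq t; rewrite inE; apply/existsP; exists q; rewrite Sq. Qed.

Lemma run_reach w r : r 0 \in init A -> is_run w r -> forall i, r i \in reach w i.
Proof. by move=> r0 run; elim=> //= i IH; apply: mem_post (run i). Qed.

Lemma reach_prefix w i q : q \in reach w i ->
  exists r, [/\ r 0 \in init A, r i = q & forall j, j < i -> step w r j \in trans A].
Proof.
elim: i q => [|i IH] q /=; first by exists (fun=> q).
rewrite inE => /existsP[p /andP[/IH[r [r0 ri rj]] t]].
exists (fun j => if j <= i then r j else q); split; rewrite ?ltnn // => j.
rewrite /step ltnS => ji; rewrite ji; case: ltngtP ji => // [ji _|-> _].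
  exact: rj.
by rewrite ri.
Qed.

End Runs.

(** * The complement automaton and its correctness *)

Lemma card_finset (T : finType) : #|{set T}| = 2 ^ #|T|.
Proof. by have := card_powerset [set: T]; rewrite powersetT !cardsT. Qed.

Section Complement.
Variables (Sigma : finType) (k : nat) (A : tela Sigma k) (J : finType).
Variables (F I : J -> {set 'I_k}) (K : nat).
Notation Q := (state A).
Let n := #|state A|.

(** A ranking and a breakpoint set. Ranks up to [n.*2] suffice because a level has at most [n]
    states; values outside the reachable set carry no meaning. *)
Definition component := ({ffun Q -> 'I_n.*2.+1 * 'I_k} * {set Q})%type.
Implicit Types (w : nat -> Sigma) (x y : component) (f g : {ffun Q -> 'I_n.*2.+1 * 'I_k}).
Implicit Types (S : {set Q}) (a : Sigma) (j : J).

Definition rank f (q : Q) : nat * 'I_k := (val (f q).1, (f q).2).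

Definition avoiding j (t : Q * Sigma * Q) : bool :=
  (t \in trans A) && [disjoint F j & colour t].

(** The breakpoint construction of Miyano and Hayashi: an empty set is refilled with all even-ranked
    states, a nonempty one passes to its even-ranked successors. It empties infinitely often iff no
    path avoiding [F j] keeps even ranks forever. *)
Definition next_breakpoint j S a (O : {set Q}) g : {set Q} :=
  [set q' in post S a | ~~ odd (rank g q').1 &&
    ((O == set0) || [exists q in O, avoiding j (q, a, q')])].

(* Transitions with a colour of [F j] do not constrain the ranks: a run may
   take finitely many of them before it starts being tracked. *)
Definition component_step j S a x y : bool :=
  [&& [forall q in S, odd (rank x.1 q).1 ==> ((rank x.1 q).2 \in I j)],
      [forall q in S, forall q', avoiding j (q, a, q') ==>
         rank_step (colour (q, a, q')) (rank x.1 q) (rank y.1 q')]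
    & y.2 == next_breakpoint j S a x.2 y.1].

Definition complement_state := ({set Q} * {ffun J -> component})%type.

(** Initial rankings and breakpoint sets are arbitrary. A colour that indexes no component lies on
    every transition, so [K] may exceed the number of components. *)
Definition complement_tela : tela Sigma K :=
  @Tela Sigma K complement_state
    [set t : complement_state * Sigma * complement_state | (t.2.1 == post t.1.1.1 t.1.2) &&
       [forall j, component_step j t.1.1.1 t.1.2 (t.1.1.2 j) (t.2.2 j)]]
    [set s : complement_state | s.1 == init A]
    (fun t : complement_state * Sigma * complement_state => [set c : 'I_K |
       [forall j, (enum_rank j == c :> nat) ==> ((t.1.1.2 j).2 == set0)]])
    (\big[@FAnd K/FTrue]_(j < K) FInf j).

Lemma card_complement_tela :
  #|state complement_tela| =
  2 ^ n * ((n.*2.+1 * k) ^ n * 2 ^ n) ^ #|J|.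
Proof.
by rewrite /= card_prod card_ffun card_prod card_ffun card_prod !card_ord !card_finset.
Qed.

Hypothesis J_le : #|J| <= K.
Hypothesis acc_cover : forall M : {set 'I_k},
  sat (fun c => c \in M) (acc A) <->
  exists j, [disjoint F j & M] && (I j \subset M).

Lemma acc_coverP (M : 'I_k -> Prop) :
  sat M (acc A) <->
  exists j, (forall c, c \in F j -> ~ M c) /\ (forall c, c \in I j -> M c).
Proof.
pose Ms := [set c | `[< M c >]].
have MsE c : c \in Ms <-> M c by rewrite inE; split=> /asboolP.
rewrite -(sat_iff _ MsE) acc_cover; split=> -[j].
  move=> /andP[/pred0P dis /subsetP sub]; exists j; split=> c cj.
    by move/MsE=> cM; have := dis c; rewrite /= cj cM.
  by apply/MsE/sub.
move=> [Fj Ij]; exists j; apply/andP; split.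
  by apply/pred0P=> c /=; apply/negP=> /andP[/Fj nM /MsE].
by apply/subsetP=> c /Ij/MsE.
Qed.

Lemma inf_breakpoint w (R : nat -> state complement_tela) j :
  inf_colours w R (widen_ord J_le (enum_rank j)) <->
  forall i, exists2 l, i <= l & ((R l).2 j).2 = set0.
Proof.
rewrite inf_coloursP; split=> cR i; have [l il cl] := cR i; exists l => //.
  by move: cl; rewrite inE => /forallP/(_ j); rewrite eqxx => /eqP.
rewrite inE; apply/forallP=> j'; apply/implyP=> /eqP/val_inj/enum_rank_inj->.
by apply/eqP.
Qed.

Lemma complement_reach w (R : nat -> state complement_tela) :
  R 0 \in init complement_tela -> is_run w R -> forall i, (R i).1 = reach A w i.
Proof.
rewrite inE => /eqP R0 run; elim=> //= i <-.
by have := run i; rewrite inE => /andP[/eqP].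
Qed.

(** An accepting run of [A] lies in some cube [j] and eventually avoids [F j], so its rank becomes
    constant. An odd constant rank contradicts the recurrence of its colour, which forces descents;
    an even one keeps the run in the breakpoint set after the next refill. *)
Lemma complement_sound w : language complement_tela w -> ~ language A w.
Proof.
move=> [R [R0 Rrun /sat_big_FAnd Racc]] [r [r0 rrun /acc_coverP[j [Fj Ij]]]].
have reachR := complement_reach R0 Rrun.
have reachr i : r i \in reach A w i by apply: run_reach.
pose rk i := rank ((R i).2 j).1 (r i).
have Rstep i : component_step j (reach A w i) (w i) ((R i).2 j) ((R i.+1).2 j).
  by have := Rrun i; rewrite inE /= !reachR => /andP[_ /forallP]; apply.
have [N avoidN] : exists N, forall i, N <= i -> avoiding j (step w r i).
  have [|N NP] := @fin_eventually _ (fun c => c \in F j)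
      (fun c i => c \notin colour (step w r i)).
    by move=> c cj; apply/not_inf_coloursP/Fj.
  exists N => i Ni; rewrite /avoiding rrun; apply/pred0P=> c /=.
  by apply/negP=> /andP[/(NP i Ni)/negP].
have rk_step i : N <= i -> rank_step (colour (step w r i)) (rk i) (rk i.+1).
  move=> Ni; have /and3P[_ /forall_inP/(_ _ (reachr i))/forallP/(_ (r i.+1))] := Rstep i.
  by move/implyP=> + _; apply; apply: avoidN.
have [i Ni|N' NN' rkN'] := @eventually_constant (fun i => (rk i).1) N.
  by have /orP[/ltnW|/andP[/eqP->]] := rk_step i Ni.
have rk_const i : N' <= i -> rk i = rk N' /\
    ~~ (odd (rk N').1 && ((rk N').2 \in colour (step w r i))).
  move=> N'i; suff rkE : rk i = rk N'.
    split=> //; have := rk_step i (leq_trans NN' N'i).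
    by rewrite /rank_step !rkN' ?(leqW N'i) // ltnn rkE => /andP[].
  elim: i N'i => [|i IH]; rewrite leq_eqVlt => /orP[/eqP<-|] //.
  rewrite ltnS => N'i; have := rk_step i (leq_trans NN' N'i).
  by rewrite /rank_step !rkN' ?(leqW N'i) // ltnn => /andP[/eqP-> _]; apply: IH.
have breaks := (inf_breakpoint w R j).1 (Racc _).
case: (boolP (odd (rk N').1)) => [rk_odd|rk_even].
  have /Ij/inf_coloursP/(_ N')[i N'i ci] : (rk N').2 \in I j.
    have /and3P[/forall_inP/(_ _ (reachr N'))/implyP + _ _] := Rstep N'.
    exact.
  by have [_] := rk_const i N'i; rewrite rk_odd ci.
have [i N'i Oi] := breaks N'.
(* The set is empty at [i], hence refilled at [i.+1]; from then on it contains the state of the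
   run. *)
have tracked l : i < l -> r l \in ((R l).2 j).2.
  elim: l => // l IH; rewrite ltnS => il.
  have /and3P[_ _ /eqP->] := Rstep l; rewrite inE (reachr l.+1) /=.
  have -> : ~~ odd (rank ((R l.+1).2 j).1 (r l.+1)).1.
    by have [rkE _] := rk_const l.+1 (leqW (leq_trans N'i il)); rewrite -/(rk _) rkE.
  move: il; rewrite leq_eqVlt => /orP[/eqP<-|il]; first by rewrite Oi eqxx.
  apply/orP; right; apply/existsP; exists (r l); rewrite IH //=.
  by apply: avoidN; apply: leq_trans (ltnW il); apply: leq_trans N'i.
have [l il Ol] := breaks i.+1.
by have := tracked l il; rewrite Ol inE.
Qed.

(** A path avoiding [F j] on which every colour of [I j] recurs would, after a finite run leading to
    its start, be an accepting run of [A]. *)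
Lemma no_cover_path w j : ~ language A w ->
  no_gen_buchi_path (fun i q q' => avoiding j (q, w i, q'))
    (fun i q q' => colour (q, w i, q')) (I j) (reach A w).
Proof.
move=> nL N r rP; apply: contrapT => nocol; apply: nL.
have [p [p0 pN prun]] := reach_prefix (rP N (leqnn N)).1.
pose s i := if i < N then p i else r i.
have sr i : N <= i -> step w s i = (r i, w i, r i.+1).
  by move=> Ni; rewrite /step /s !ltnNge Ni (leqW Ni).
exists s; split.
- by rewrite /s; case: (posnP N) => // N0; move: pN p0; rewrite N0 => ->.
- move=> i; case: (ltnP i N) => [iN|Ni]; last first.
    by rewrite sr //; have [_ /andP[]] := rP i Ni.
  have := prun i iN; rewrite /step /s iN; case: ltnP => // Ni.
  have iN' : i.+1 = N by apply/eqP; rewrite eqn_leq iN Ni.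
  by rewrite iN' pN.
apply/acc_coverP; exists j; split=> c cj.
  apply/not_inf_coloursP; exists N => i Ni; rewrite sr //.
  have [_ /andP[_ /pred0P/(_ c)]] := rP i Ni.
  by rewrite /= cj /= => ->.
apply/inf_coloursP=> i; apply: contrapT => ni; apply: nocol; exists c => //.
exists (maxn i N) => l; rewrite geq_max => /andP[il Nl].
by apply/negP=> cl; apply: ni; exists l => //; rewrite sr.
Qed.

(** Each component follows the ranking from [ranking_exists]. If its breakpoint set were empty only
    finitely often, [konig] would yield a path of even ranks inside it, which this ranking
    excludes. *)
Lemma complement_complete (c0 : 'I_k) w : ~ language A w -> language complement_tela w.
Proof.
move=> nL.
have /choice[f fP] j := @ranking_exists Q k c0 _ _ _ n (reach A w)
  (ex_intro _ 0 (fun i _ => max_card _)) (no_cover_path (j := j) nL).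
pose g j i := [ffun q => (inord (f j i q).1, (f j i q).2)] : {ffun Q -> 'I_n.*2.+1 * 'I_k}.
have gE j i q : rank (g j i) q = f j i q.
  have [f_le _ _ _] := fP j.
  by rewrite /rank ffunE /= inordK ?ltnS //; case: (f j i q).
pose O j := fix O i := if i is i'.+1 then
  next_breakpoint j (reach A w i') (w i') (O i') (g j i) else set0.
pose R i : state complement_tela := (reach A w i, [ffun j => (g j i, O j i)]).
exists R; split; first by rewrite inE.
  move=> i; rewrite inE eqxx; apply/forallP=> j; rewrite !ffunE.
  have [_ f_odd f_step _] := fP j; apply/and3P; split=> //.
    by apply/forall_inP=> q _; apply/implyP; rewrite gE; apply: f_odd.
  apply/forall_inP=> q Sq; apply/forallP=> q'; apply/implyP=> av.
  rewrite !gE; apply: f_step => //; apply: mem_post Sq _.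
  by case/andP: av.
apply/sat_big_FAnd=> c; case: (pselect (exists j, enum_rank j = c :> nat)).
  move=> [j jc]; have -> : c = widen_ord J_le (enum_rank j) by apply/val_inj.
  apply/inf_breakpoint=> i; apply: contrapT => nO.
  have O_neq0 l : i < l -> O j l != set0.
    move=> il; apply/eqP=> Ol; apply: nO; exists l; first exact: ltnW.
    by rewrite ffunE.
  have [|l q' il|r rP] := @konig Q (fun l q q' => avoiding j (q, w l, q')) (O j) i.+1.
  - exact: O_neq0.
  - rewrite inE => /and3P[_ _]; rewrite (negPf (O_neq0 l il)).
    by move=> /existsP[q /andP[Oq av]]; exists q.
  have Oreach l q : q \in O j l -> q \in reach A w l /\ ~~ odd (f j l q).1.
    case: l => [|l]; first by rewrite inE.
    by rewrite inE gE => /and3P[].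
  have [_ _ _ f_path] := fP j.
  have [|l il] := f_path i.+1 r; last first.
    by have [/Oreach[_ /negP]] := rP l il.
  by move=> l il; have [/Oreach[]] := rP l il.
move=> nj; apply/inf_coloursP=> i; exists i => //; rewrite inE.
by apply/forallP=> j; apply/implyP=> /eqP jc; case: nj; exists j.
Qed.

End Complement.

(** * Size estimates *)

(** A permutation [s] yields the tight function sending [i] to [(s i).*2.+1], whose image is the set
    of all odd numbers up to [n.*2.+1]. *)
Lemma fact_leq_tight n : (n.+1)`! <= tight n.+1.
Proof.
pose odds (s : 'S_n.+1) : {ffun 'I_n.+1 -> 'I_(n.+1).*2} :=
  [ffun i => inord (s i).*2.+1].
have oddsE s i : odds s i = (s i).*2.+1 :> nat.
  by rewrite ffunE inordK // !ltnS leq_double -ltnS.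
have odds_inj : injective odds.
  move=> s t st; apply/permP=> i; apply/val_inj/double_inj/succn_inj.
  by rewrite -!oddsE st.
have card_S : #|[set: 'S_n.+1]| = (n.+1)`!.
  by rewrite cardsT card_Sn.
rewrite -card_S -(card_imset _ odds_inj); apply: subset_leq_card.
apply/subsetP=> _ /imsetP[s _ ->]; rewrite inE /is_tight.
have hit t : t <= n -> exists i, odds s i = t.*2.+1 :> nat.
  by move=> tn; exists ((s^-1)%g (inord t)); rewrite oddsE permKV inordK.
have -> : \max_(i < n.+1) odds s i = n.*2.+1.
  apply/eqP; rewrite eqn_leq; apply/andP; split.
    by apply/bigmax_leqP=> i _; rewrite -ltnS -[X in _ < X]doubleS.
  by have [i <-] := hit n (leqnn n); apply: leq_bigmax.
rewrite /= odd_double; apply/forallP=> t; apply/implyP=> t_odd.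
have tE : t = (t./2).*2.+1 :> nat by rewrite -[LHS]odd_double_half t_odd.
have [|i iE] := hit t./2; last by apply/existsP; exists i; rewrite iE -tE.
by have := ltn_ord t; rewrite {1}tE !ltnS leq_double.
Qed.

(** The falling factorial [(n + n) ^_ n] is at least [n ^ n], and it is the factorial of [n] times a
    binomial coefficient of at most [2 ^ (n + n)]. *)
Lemma expnn_leq_fact n : n ^ n <= 4 ^ n * n`!.
Proof.
have bin_le m i : 'C(m, i) <= 2 ^ m.
  elim: m i => [|m IH] [|i] //; first by rewrite bin0 expn_gt0.
  by rewrite binS expnS mul2n -addnn leq_add.
have exp_le a m : a ^ m <= (a + m) ^_ m.
  elim: m => // m IH; rewrite addnS ffactSS expnS; apply: leq_mul => //.
  by rewrite leqW ?leq_addr.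
apply: leq_trans (exp_le n n) _; rewrite -bin_ffact leq_mul2r.
by rewrite -[4]/(2 ^ 2) -expnM mul2n -addnn bin_le orbT.
Qed.

(* If [b <= n * k.+1] the constant 1 would do; otherwise n and k are below b. *)
Lemma bounded_base_exponent b : exists C, forall n k,
  b ^ (n * 2 ^ k) <= C * (n * k.+1) ^ (n * 2 ^ k).
Proof.
(* The base is [b.+1] so that the power is monotone in the exponent even for [b = 0]. *)
exists (b.+1 ^ (b * 2 ^ b)) => n k; case: (posnP n) => [->|n_gt0].
  by rewrite !mul0n !expn0 muln1 expn_gt0.
case: (leqP b (n * k.+1)) => [le_b|lt_b].
  apply: leq_trans (leq_pmull _ _); last by rewrite expn_gt0.
  by rewrite leq_exp2r // muln_gt0 n_gt0 expn_gt0.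
have nb : n <= b by apply: leq_trans (ltnW lt_b); apply: leq_pmulr.
have kb : k <= b.
  by apply: leq_trans (leqnSn k) (leq_trans _ (ltnW lt_b)); apply: leq_pmull.
apply: leq_trans (leq_pmulr _ _); last by rewrite expn_gt0 muln_gt0 n_gt0.
apply: (@leq_trans (b.+1 ^ (n * 2 ^ k))).
  by rewrite leq_exp2r ?leqnSn // muln_gt0 n_gt0 expn_gt0.
by rewrite leq_pexp2l // leq_mul // leq_pexp2l.
Qed.

(** 12 = 2 * 3 * 2: a 2 for the reachable set, absorbed into the power [h], the 3 from
    [n.*2.+1 <= 3 * n], and a 2 for the breakpoint set. *)
Lemma size_bound n k h : 0 < h ->
  2 ^ n * ((n.*2.+1 * k) ^ n * 2 ^ n) ^ h <= (12 * (n * k)) ^ (n * h).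
Proof.
move=> h_gt0; case: (posnP n) => [->|n_gt0]; first by rewrite exp1n.
apply: (@leq_trans ((2 ^ n) ^ h * ((n.*2.+1 * k) ^ n * 2 ^ n) ^ h)).
  rewrite leq_mul2r; apply/orP; right.
  by rewrite -{1}(expn1 (2 ^ n)) leq_pexp2l ?expn_gt0.
rewrite -expnMn -!expnMn -expnM leq_exp2r ?muln_gt0 ?n_gt0 //.
rewrite (_ : 12 * (n * k) = 2 * (3 * n * k * 2)); last first.
  by rewrite !mulnA (mulnC _ 2) !mulnA.
have n3 : n.*2.+1 <= 3 * n by rewrite (mulSn 2) mul2n -add1n leq_add2r.
by rewrite leq_mul2l !leq_mul2r n3 !orbT.
Qed.

(* 192 = 12 * 4 ^ 2, from [n ^ n <= 4 ^ n * n`!] squared. *)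
Lemma size_le_tight n k h b C :
  0 < h -> 192 ^ (n * h) <= C * (n * k) ^ (n * h) ->
  b <= (12 * (n * k)) ^ (n * h) ->
  b <= C * (k ^ (n * (2 * h)) * tight n.+1 ^ (2 * h)).
Proof.
move=> h_gt0 leC /leq_trans; apply; set e := n * h in leC *.
have e2 : n * (2 * h) = 2 * e by rewrite mulnCA.
have fact_le : (n ^ n) ^ (2 * h) <= (4 ^ n * tight n.+1) ^ (2 * h).
  rewrite leq_exp2r ?muln_gt0 ?h_gt0 //.
  apply: leq_trans (expnn_leq_fact n) _; rewrite leq_mul2l.
  apply/orP; right; apply: leq_trans (fact_leq_tight n).
  by rewrite factS leq_pmull.
rewrite expnMn -!expnM e2 in fact_le.
have nk_le : (n * k) ^ e * (n * k) ^ e <=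
    16 ^ e * (k ^ (n * (2 * h)) * tight n.+1 ^ (2 * h)).
  rewrite mulnn -expnM (mulnC e) e2 expnMn mulnC mulnCA leq_mul2l; apply/orP; right.
  by rewrite -[16]/(4 ^ 2) -expnM.
have c192 : 16 ^ e * (12 * (n * k)) ^ e = 192 ^ e * (n * k) ^ e.
  by rewrite -!expnMn mulnA.
(* After multiplication by [16 ^ e], the hypothesis trades [192 ^ e] for the second factor
   [(n * k) ^ e] that [nk_le] has to spare. *)
rewrite -(leq_pmul2l (_ : 0 < 16 ^ e)) ?expn_gt0 // c192 mulnCA.
apply: leq_trans (leq_mul leC (leqnn _)) _.
by rewrite -mulnA leq_mul2l nk_le orbT.
Qed.

Local Open Scope ring_scope.

(* 24 = 12 * 2, from [1 / 2 <= (76 / 100) ^ 2]. *)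
Lemma size_le_power n k h b C :
  (0 < n)%N -> (24 ^ (n * h) <= C * (n * k) ^ (n * h))%N ->
  (b <= (12 * (n * k)) ^ (n * h))%N ->
  (b%:R : rat) <= C%:R * (n%:R ^+ (2 * h)
     * (76%:R / 100%:R * n%:R * k%:R) ^+ (n * (2 * h))).
Proof.
move=> n_gt0 leC leb; set e := (n * h)%N in leC leb.
have -> : (n * (2 * h) = 2 * e)%N by rewrite mulnCA.
have [q_ge0 q2_ge] : 0 <= 76%:R / 100%:R :> rat /\
    2%:R^-1 <= (76%:R / 100%:R) ^+ 2 :> rat by lra.
move: (76%:R / 100%:R) q_ge0 q2_ge => q q_ge0 q2_ge.
(* The factor [n%:R ^+ (2 * h)] is at least 1 and is dropped; what remains is
   [b * 2 ^ e <= C * ((n * k) ^ 2) ^ e]. *)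
apply: (@le_trans _ _ (C%:R * (2%:R^-1 * (n * k)%:R ^+ 2) ^+ e)); last first.
  apply: ler_wpM2l => //; rewrite [leRHS](_ : _ = n%:R ^+ (2 * h) *
    (q ^+ 2 * (n * k)%:R ^+ 2) ^+ e); last first.
    by rewrite -exprMn -exprM natrM mulrA.
  have nk_ge0 : 0 <= (n * k)%:R ^+ 2 :> rat by rewrite exprn_ge0 ?ler0n.
  rewrite -[leLHS]mul1r; apply: ler_pM; first exact: ler01.
  - by rewrite exprn_ge0 ?mulr_ge0 ?invr_ge0 ?ler0n.
  - by rewrite exprn_ege1 ?ler1n.
  - by rewrite lerXn2r ?nnegrE ?mulr_ge0 ?invr_ge0 ?ler0n ?sqr_ge0 ?ler_wpM2r.
rewrite exprMn mulrCA exprVn mulrC ler_pdivlMr ?exprn_gt0 //.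
rewrite -!natrX -!natrM ler_nat.
apply: leq_trans (leq_mul leb (leqnn _)) _.
rewrite -expnMn (_ : 12 * (n * k) * 2 = 24 * (n * k))%N; last by rewrite mulnAC.
by rewrite expnMn -mulnn (expnMn (n * k)%N (n * k)) mulnA leq_mul2r leC orbT.
Qed.

(** Positivity excludes bounds equal to 0: the first for [k = 0 < n], the second for [n = 0]. Over a
    nonempty alphabet, the complement of an empty language needs a state. *)
Theorem theorem6 :
  exists C1 C2 : nat,
    forall (n k : nat) (Sigma : finType) (A : tela Sigma k),
      (0 < k)%N -> #|state A| = n ->
      exists B : tela Sigma (2 ^ k)%N,
        [/\ generalized_buchi B,
            forall w : nat -> Sigma, language B w <-> ~ language A w,
            (#|state B| <= C1 * (k ^ (n * 2 ^ k) * tight n.+1 ^ (2 ^ k)))%N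
          & (0 < n)%N ->
            (#|state B|%:R : rat) <=
              C2%:R * (n%:R ^+ (2 ^ k)
                       * (76%:R / 100%:R * n%:R * k%:R) ^+ (n * 2 ^ k))].
Proof.
have [C1 leC1] := bounded_base_exponent 192.
have [C2 leC2] := bounded_base_exponent 24.
exists C1, C2 => n [//|k] Sigma A _ cardA.
pose P (M : {set 'I_k.+1}) := `[< sat (fun c => c \in M) (acc A) >].
have [F [I cover]] := cube_cover P.
have acc_cover (M : {set 'I_k.+1}) : sat (fun c => c \in M) (acc A) <->
    exists j, [disjoint F j & M] && (I j \subset M).
  have := cover M; rewrite /P => PM; split=> [/asboolP|/existsP].
    by rewrite PM => /existsP.
  by rewrite -PM => /asboolP.
have cardJ : #|{: {set 'I_k}}| = (2 ^ k)%N by rewrite card_finset card_ord.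
have J_le : (#|{: {set 'I_k}}| <= 2 ^ k.+1)%N by rewrite cardJ leq_exp2l.
have h_gt0 : (0 < 2 ^ k)%N by rewrite expn_gt0.
(* With [k.+1] colours in [A] there are [2 ^ k] components, half the number of colours of the
   complement; hence [h = 2 ^ k] and the exponents [2 * h]. *)
exists (complement_tela A F I (2 ^ k.+1)).
have := size_bound n k.+1 h_gt0; rewrite -cardJ -cardA.
rewrite -(card_complement_tela A F I (2 ^ k.+1)) cardJ cardA => le_size.
split=> //.
- move=> w; split; first exact: (complement_sound J_le acc_cover).
  exact: (complement_complete J_le acc_cover ord0).
- by rewrite expnS; apply: size_le_tight => //; apply: leC1.
- by rewrite expnS => n_gt0; apply: size_le_power => //; apply: leC2.
Qed.
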